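(* Let $n\ge 1$ be an integer, let $q$ be a prime power, and let $\mathcal{C}\subseteq \mathrm{U}(n,\mathbb{F}_q)$ be a linear flag-rank-metric code with minimum distance $\delta$. If $\mathcal{C}$ is perfect, then $\delta$ is odd.
   Context: $\mathbb{F}_q$ is the finite field with $q$ elements. $\mathrm{U}(n,\mathbb{F}_q)$ is the $\mathbb{F}_q$-vector space of $n\times n$ upper triangular matrices over $\mathbb{F}_q$. For $M\in \mathrm{U}(n,\mathbb{F}_q)$ and $1\le i\le n$, $M_{[i]}$ is the $i\times(n-i+1)$ submatrix of $M$ obtained by deleting the first $i-1$ columns and the last $n-i$ rows (i.e. rows $1,\dots,i$ and columns $i,\dots,n$). The flag-rank weight of $M$ is $\mathrm{fr}(M)=\sum_{i=1}^{n}\mathrm{rk}(M_{[i]})$; the flag-rank distance is $\mathrm{d}_{\mathrm{fr}}(A,B)=\mathrm{fr}(A-B)$. A linear flag-rank-metric code is an $\mathbb{F}_q$-subspace $\mathcal{C}$ of $\mathrm{U}(n,\mathbb{F}_q)$; its minimum (flag-rank) distance, defined when $\mathcal{C}\neq\{\boldsymbol{0}\}$, is $\delta=\min\{\mathrm{fr}(M):M\in\mathcal{C}\setminus\{\boldsymbol{0}\}\}$ (so a code ''with minimum distance $\delta$'' is nonzero). Let $b_q(n,t)=|\{A\in \mathrm{U}(n,\mathbb{F}_q):\mathrm{fr}(A)\le t\}|$. A code $\mathcal{C}$ with minimum distance $\delta$ is perfect if $|\mathcal{C}|\,b_q(n,t)=q^{\frac{n(n+1)}{2}}$, where $t=\left\lfloor\frac{\delta-1}{2}\right\rfloor$.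 *)

(* Defs.v *)
From HB Require Import structures.
From mathcomp Require Import all_boot all_order all_algebra.
Set Implicit Arguments.
Unset Strict Implicit.
Unset Printing Implicit Defensive.
Import GRing.Theory.
Local Open Scope ring_scope.

(* MathComp's [is_trig_mx] means LOWER triangular, hence the transpose. *)
Definition upper_trig (F : finFieldType) (n : nat) (M : 'M[F]_n) : bool :=
  is_trig_mx M^T.

Lemma shift_ord_subproof (n : nat) (i : 'I_n) (j : 'I_(n - i)) : (i + j < n)%N.
Proof. by rewrite -ltn_subRL ltn_ord. Qed.

Definition shift_ord (n : nat) (i : 'I_n) (j : 'I_(n - i)) : 'I_n :=
  Ordinal (shift_ord_subproof j).

(* Indices are 0-based: for i : 'I_n this is the block of rows 0, ..., i and
   columns i, ..., n - 1, i.e. M_[i+1] in 1-based notation. *)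
Definition corner_mx (F : finFieldType) (n : nat) (M : 'M[F]_n) (i : 'I_n) :
    'M[F]_(i.+1, n - i) :=
  mxsub (widen_ord (ltn_ord i)) (@shift_ord n i) M.

Definition flag_rank (F : finFieldType) (n : nat) (M : 'M[F]_n) : nat :=
  (\sum_(i < n) \rank (corner_mx M i))%N.

Definition linear_flag_rank_code (F : finFieldType) (n : nat)
    (C : {vspace 'M[F]_n}) : Prop :=
  forall M : 'M[F]_n, M \in C -> upper_trig M.

(* delta is attained by a nonzero codeword, so in particular C is nonzero. *)
Definition min_distance (F : finFieldType) (n : nat)
    (C : {vspace 'M[F]_n}) (delta : nat) : Prop :=
  (exists M : 'M[F]_n, [/\ M \in C, M != 0 & flag_rank M = delta]) /\
  (forall M : 'M[F]_n, M \in C -> M != 0 -> (delta <= flag_rank M)%N).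

Definition ball_size (F : finFieldType) (n t : nat) : nat :=
  #|[set A : 'M[F]_n | upper_trig A & (flag_rank A <= t)%N]|.

(* Meant for delta the minimum distance of C. *)
Definition perfect_code (F : finFieldType) (n : nat)
    (C : {vspace 'M[F]_n}) (delta : nat) : Prop :=
  (#|[set M : 'M[F]_n | M \in C]| * ball_size F n ((delta - 1) %/ 2)
    = #|F| ^ ((n * (n + 1)) %/ 2))%N.

(* Main.v *)
(* If delta = 2(t+1), any upper triangular X with fr(X) = t+1 lies outside
   every ball of radius t around a codeword: it is at distance t+1 from 0 and,
   by the triangle inequality, at distance at least t+1 from any other codeword.
   Since the balls are disjoint, perfection would force them to cover everything.
   Such an X exists because t+1 is at most n(n+1)/4, and every weight in this
   range is that of a partial permutation matrix: a one in position (a, b)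
   contributes exactly b - a + 1. *)
Require Import Defs.
From HB Require Import structures.
From mathcomp Require Import all_boot all_order all_algebra.
From mathcomp Require Import zify.
Import GRing.Theory.
Local Open Scope ring_scope.

(** * Norm properties of the flag rank *)

Section FlagRank.
Variables (F : finFieldType) (n : nat).
Implicit Types (A B M : 'M[F]_n) (i j c : 'I_n).

Lemma upper_trigP A :
  reflect (forall i j, (j < i)%N -> A i j = 0) (upper_trig A).
Proof.
apply: (iffP is_trig_mxP) => utA i j ltij; last by rewrite mxE utA.
by have := utA j i ltij; rewrite mxE.
Qed.

Lemma upper_trigD A B :
  upper_trig A -> upper_trig B -> upper_trig (A + B).
Proof.
move=> /upper_trigP utA /upper_trigP utB; apply/upper_trigP => i j ltji.
by rewrite mxE utA ?utB ?addr0.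
Qed.

Lemma flag_rankD A B :
  (flag_rank (A + B) <= flag_rank A + flag_rank B)%N.
Proof.
rewrite -big_split leq_sum //= => c _.
have -> : corner_mx (A + B) c = corner_mx A c + corner_mx B c.
  by apply/matrixP => i j; rewrite !mxE.
exact: mxrank_add.
Qed.

Lemma flag_rankN A : flag_rank (- A) = flag_rank A.
Proof.
apply: eq_bigr => c _.
have -> : corner_mx (- A) c = - corner_mx A c.
  by apply/matrixP => i j; rewrite !mxE.
exact: mxrank_opp.
Qed.

Lemma flag_rankB A B :
  (flag_rank (A - B) <= flag_rank A + flag_rank B)%N.
Proof. by rewrite -[flag_rank B]flag_rankN flag_rankD. Qed.

(** Each entry on or above the diagonal lies in the last row of the corner indexed by its row. *)
Lemma flag_rank_eq0 A : upper_trig A -> flag_rank A = 0%N -> A = 0.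
Proof.
move=> /upper_trigP utA /eqP; rewrite sum_nat_eq0 => /forallP /= fr0.
apply/matrixP => i j; rewrite mxE; case: (ltnP j i) => [/utA //|leij].
have := fr0 i; rewrite mxrank_eq0 => /eqP /matrixP.
have ltji : (j - i < n - i)%N by have := ltn_ord j; lia.
move=> /(_ ord_max (Ordinal ltji)); rewrite !mxE => <-.
by congr (A _ _); apply: val_inj => /=; lia.
Qed.

(** Corner [c] has [c.+1] rows and [n - c] columns, so twice its rank is at most [n.+1]. *)
Lemma flag_rank_upper_bound A : (2 * flag_rank A <= n * n.+1)%N.
Proof.
have -> : (n * n.+1 = \sum_(c < n) n.+1)%N by rewrite sum_nat_const card_ord.
rewrite big_distrr /= leq_sum // => c _.
have := rank_leq_row (corner_mx A c); have := rank_leq_col (corner_mx A c).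
have := ltn_ord c; lia.
Qed.

End FlagRank.

(** * Weights of partial permutation matrices *)

Lemma ltn_sum_initial_segment (K a : nat) (P : pred nat) :
  (forall b b', (b' < b < K)%N -> P b -> P b') ->
  (a < \sum_(b < K) P b)%N = (a < K)%N && P a.
Proof.
elim: K => [|K IHK] decP; first by rewrite big_ord0.
have {}IHK : (a < \sum_(b < K) P b)%N = (a < K)%N && P a.
  by apply: IHK => b b' ltb; apply: decP; lia.
rewrite big_ord_recr /=; case PK: (P K); last first.
  rewrite addn0 IHK ltnS [(a <= K)%N]leq_eqVlt; case: eqP => [->|//].
  by rewrite ltnn /= PK.
have allP : forall b : nat, (b < K)%N -> P b.
  by move=> b ltbK; apply: (decP K) => //; rewrite ltbK ltnSn.
rewrite (eq_bigr (fun=> 1%N)) => [|b _]; last by rewrite allP.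
rewrite sum_nat_const card_ord muln1 addn1.
case: (ltnP a K.+1) => //=; rewrite ltnS leq_eqVlt => /orP[/eqP->|/allP->] //.
Qed.

Lemma sum_interval_indicator (n a b : nat) :
  (a <= b < n)%N -> (\sum_(c < n) (a <= c <= b) = b.+1 - a)%N.
Proof.
move=> /andP[leab ltbn].
rewrite -(big_mkord xpredT (fun c => nat_of_bool (a <= c <= b)%N)).
rewrite (@big_cat_nat _ _ _ a) /=; [|lia|lia].
rewrite (@big_cat_nat _ _ _ b.+1 a) /=; [|lia|lia].
rewrite big_nat_cond big1 => [|c]; last by lia.
rewrite [X in (_ + (_ + X))%N]big_nat_cond [X in (_ + (_ + X))%N]big1 => [|c]; last by lia.
rewrite add0n addn0 big_nat_cond (eq_bigr (fun=> 1%N)) => [|c]; last by lia.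
by rewrite -big_nat_cond sum_nat_const_nat muln1.
Qed.

Definition partial_perm_mx (F : finFieldType) (n K : nat) (col : nat -> nat)
  : 'M[F]_n := \matrix_(i, j) ((i < K)%N && (j == col i :> nat))%:R.

Section PartialPerm.
Variables (F : finFieldType) (n K : nat) (col : nat -> nat).
Hypothesis col_dec : forall a b, (a < b < K)%N -> (col b < col a)%N.
Hypothesis col_bound : forall a, (a < K)%N -> (a <= col a < n)%N.
Let X : 'M[F]_n := partial_perm_mx F n K col.

Lemma upper_trig_partial_perm_mx : upper_trig X.
Proof.
apply/upper_trigP => i j ltji; rewrite mxE.
case: (ltnP i K) => //= /col_bound; case: eqP => //; lia.
Qed.

(* The corner A satisfies A A^T = D and D A = A for the diagonal projection D
   onto its nonzero rows, which are the topmost ones since [col] decreases. *)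
Lemma rank_corner_partial_perm_mx (c : 'I_n) :
  \rank (corner_mx X c) = (\sum_(a < K) (a <= c <= col a))%N.
Proof.
set r := (\sum_(a < K) _)%N; set A := corner_mx X c.
(* The condition is downward closed in [a], so the count [r] is also the threshold below which it
   holds. *)
have ltr a : (a < r)%N = (a < K)%N && (a <= c <= col a)%N.
  rewrite (@ltn_sum_initial_segment _ _ (fun a => (a <= c <= col a)%N)) //.
  by move=> b b' ltb; have := col_dec _ _ ltb; lia.
have ler : (r <= c.+1)%N.
  by rewrite leqNgt; apply/negP; rewrite ltr; lia.
have AE i j : A i j = ((i < r)%N && (c + j == col i)%N)%:R.
  rewrite !mxE /= ltr; congr (_%:R).
  have := ltn_ord i; case: (i < K)%N => //=.
  by case: eqP => //; lia.
have AAT : A *m A^T = pid_mx r.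
  apply/matrixP => i k; rewrite !mxE.
  have [ltir|leri] := boolP (i < r)%N; last first.
    rewrite andbF big1 // => j _.
    by rewrite AE (negPf leri) mul0r.
  have := ltir; rewrite ltr => /andP[ltiK /andP[_ lecol]].
  have /andP[_ ltcol] := col_bound _ ltiK.
  have ltj0 : (col i - c < n - c)%N by have := ltn_ord c; lia.
  rewrite (bigD1 (Ordinal ltj0)) //= big1 => [|j neqj]; last first.
    rewrite AE; case: eqP => [ej|]; last by rewrite andbF mul0r.
    by case/eqP: neqj; apply: val_inj => /=; lia.
  rewrite addr0 [A^T _ _]mxE !AE /= subnKC // ltir eqxx mul1r andbT.
  rewrite ?andbT [(k < r)%N]ltr; congr ((nat_of_bool _)%:R).
  (* Distinct nonzero rows have their ones in distinct columns, so the off-diagonal products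
     vanish. *)
  have := col_dec i k; have := col_dec k i.
  by case: (ltngtP i k) => [ltik|ltki|eqik]; rewrite -?eqik; lia.
have DA : pid_mx r *m A = A.
  apply/matrixP => i j; rewrite mxE (bigD1 i) //= big1 => [|k neqki].
    rewrite [pid_mx r i i]mxE eqxx /= !AE addr0.
    by case: (i < r)%N; rewrite ?mul1r ?mul0r.
  by rewrite mxE eq_sym (inj_eq val_inj) (negPf neqki) mul0r.
have rkD : \rank (pid_mx r : 'M[F]_c.+1) = r by rewrite rank_pid_mx.
apply/eqP; rewrite eqn_leq; apply/andP; split.
- by have := mxrankM_maxl (pid_mx r : 'M_c.+1) A; rewrite DA rkD.
- by have := mxrankM_maxl A A^T; rewrite AAT rkD.
Qed.

Lemma flag_rank_partial_perm_mx :
  flag_rank X = (\sum_(a < K) ((col a).+1 - a))%N.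
Proof.
under [LHS]eq_bigr => c _ do rewrite rank_corner_partial_perm_mx.
rewrite exchange_big; apply: eq_bigr => a _.
by rewrite sum_interval_indicator // col_bound.
Qed.

End PartialPerm.

(** * Realizing every positive weight up to n(n+1)/4 *)

Lemma antidiagonal_sum (n K : nat) :
  (2 * K <= n.+1)%N -> (\sum_(a < K) ((n.-1 - a).+1 - a) = K * (n.+1 - K))%N.
Proof.
elim: K => [|K IHK] leKn; first by rewrite big_ord0.
rewrite big_ord_recr /= IHK; [nia|lia].
Qed.

(** [K * (n.+1 - K)] is the weight of the first [K] antidiagonal ones, and the next one would add
    [n - 2 * K]. Taking [K] largest with this weight below [s] leaves a remainder [e] in the stated
    range. *)
Lemma antidiagonal_decomposition (n J s : nat) :
  (2 * J <= n.+1)%N -> (0 < s <= J * (n.+1 - J))%N ->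
  exists K e, [/\ (2 * K < n)%N, (0 < e <= n - 2 * K)%N
                & s = (K * (n.+1 - K) + e)%N].
Proof.
elim: J => [|J IHJ] leJn; first by lia.
have [lesJ|ltJs] := leqP s (J * (n.+1 - J)) => sbounds.
  by apply: IHJ; lia.
by exists J, (s - J * (n.+1 - J))%N; split; nia.
Qed.

(* Fill the antidiagonal from the corner inwards with ones; a last one, placed
   inside the antidiagonal in the next row, adjusts the weight to [s]. *)
Lemma flag_rank_attained (F : finFieldType) (n s : nat) :
  (0 < s)%N -> (4 * s <= n * n.+1)%N ->
  exists2 X : 'M[F]_n, upper_trig X & flag_rank X = s.
Proof.
move=> s_gt0 les.
(* Half the antidiagonal has weight floor((n+1)^2/4), which is at least n(n+1)/4. *)
have [||K [e [ltKn ebounds ->]]] := @antidiagonal_decomposition n n.+1./2 s.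
- lia.
- by have := odd_double_half n.+1; case: (odd n.+1); nia.
(* The one in row [K] contributes [e]: [0 < e] keeps it on or above the diagonal, and
   [e <= n - 2 * K] keeps it left of column [n - K], the last one used. *)
pose col a := if (a < K)%N then (n.-1 - a)%N else (K + e).-1.
have col_dec a b : (a < b < K.+1)%N -> (col b < col a)%N.
  by rewrite /col; case: (ltnP a K); case: (ltnP b K); lia.
have col_bound a : (a < K.+1)%N -> (a <= col a < n)%N.
  by rewrite /col; case: (ltnP a K); lia.
exists (partial_perm_mx F n K.+1 col); first exact: upper_trig_partial_perm_mx.
rewrite flag_rank_partial_perm_mx // big_ord_recr /= {2}/col ltnn.
rewrite (eq_bigr (fun a : 'I_K => (n.-1 - a).+1 - a)%N) => [|a _].
  by rewrite antidiagonal_sum; lia.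
by rewrite /col ltn_ord.
Qed.

(** * Cardinalities and the packing contradiction *)

Lemma card_upper_positions (n : nat) :
  #|[set p : 'I_n * 'I_n | (p.1 <= p.2)%N]| = ((n * (n + 1)) %/ 2)%N.
Proof.
rewrite -sum1dep_card.
rewrite -(pair_big_dep xpredT (fun i j : 'I_n => (i <= j)%N) (fun _ _ => 1%N)) /=.
rewrite (exchange_big_dep xpredT) //=.
rewrite (eq_bigr (fun j : 'I_n => j.+1)) => [|j _]; last first.
  rewrite big_mkcond -(big_mkord xpredT (fun i => if (i <= j)%N then 1%N else 0%N)) /=.
  rewrite (eq_bigr (fun i => nat_of_bool (0 <= i <= j)%N)) //.
  by rewrite big_mkord sum_interval_indicator ?subn0 ?ltn_ord.
elim: n => [|n IHn]; first by rewrite big_ord0.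
by rewrite big_ord_recr /= IHn; lia.
Qed.

Lemma card_upper_trig_leq (F : finFieldType) (n : nat) :
  (#|[set A : 'M[F]_n | upper_trig A]| <= #|F| ^ ((n * (n + 1)) %/ 2))%N.
Proof.
rewrite -card_upper_positions.
set D := [set p : 'I_n * 'I_n | _].
pose f (A : 'M[F]_n) := [ffun p : 'I_n * 'I_n => A p.1 p.2].
have f_inj : injective f.
  by move=> A B /ffunP eqf; apply/matrixP => i j; have := eqf (i, j); rewrite !ffunE.
rewrite -(card_imset _ f_inj) -(card_pffun_on 0 (mem D) (mem F)) subset_leq_card //.
apply/subsetP => _ /imsetP[A + ->]; rewrite inE => /upper_trigP utA.
apply/pffun_onP; split=> //.
apply/supportP => -[i j]; rewrite inE /= -ltnNge => ltji.
by rewrite ffunE utA.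
Qed.

Theorem proposition4p5 (F : finFieldType) (n : nat) (C : {vspace 'M[F]_n})
    (delta : nat) (hn : (1 <= n)%N) (hC : linear_flag_rank_code C)
    (hdelta : min_distance C delta) (hperf : perfect_code C delta) :
  odd delta.
Proof.
case: hdelta => -[M [CM nzM frM]] min_fr.
apply/negPn/negP => evd.
(* This excludes the even value 0, at which [delta - 1] would truncate. *)
have d_gt0 : (0 < delta)%N.
  rewrite lt0n; apply/eqP => d0; case/eqP: nzM.
  by apply: flag_rank_eq0; [exact: hC | rewrite frM].
set t := ((delta - 1) %/ 2)%N.
have dE : delta = (2 * t.+1)%N by rewrite /t; lia.
(* The bound holds because 4(t+1) is twice the weight of [M]. *)
have [//||X utX frX] := @flag_rank_attained F n t.+1.
  by have := flag_rank_upper_bound _ _ M; rewrite frM; lia.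
pose ball := [set A : 'M[F]_n | upper_trig A & (flag_rank A <= t)%N].
pose code := [set A : 'M[F]_n | A \in C].
pose add (p : 'M[F]_n * 'M[F]_n) := p.1 + p.2.
(* Disjointness of the balls: two decompositions with distinct codewords would give a nonzero
   codeword of weight at most 2t. *)
have add_inj : {in setX code ball &, injective add}.
  move=> [c A] [c' A']; rewrite !inE /= => /and3P[Cc _ leA] /and3P[Cc' _ leA'].
  rewrite /add /= => eq_add.
  have diffE : c - c' = A' - A.
    by apply/eqP; rewrite subr_eq [_ + c']addrC addrA -eq_add addrK.
  have [eqcc|neqcc] := eqVneq c c'.
    by rewrite eqcc in eq_add *; rewrite (addrI _ eq_add).
  have := min_fr (c - c'); rewrite memvB // subr_eq0 => /(_ isT neqcc).
  rewrite diffE => /leq_trans /(_ (flag_rankB _ _ _ _)); lia.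
have XnotinI : X \notin add @: setX code ball.
  apply/imsetP => -[[c A]]; rewrite !inE /add /= => /and3P[Cc _ leA] XE.
  have [c0|nzc] := eqVneq c 0.
    by move: frX; rewrite XE c0 add0r; lia.
  have := min_fr c Cc nzc; have -> : c = X - A by rewrite XE addrK.
  move=> /leq_trans /(_ (flag_rankB _ _ _ _)); lia.
(* The union of the balls already has the cardinality of the whole space by perfection; [X] makes it
   one too large. *)
have : (#|X |: add @: setX code ball| <= #|[set A : 'M[F]_n | upper_trig A]|)%N.
  apply/subset_leq_card/subsetP => Y; rewrite in_setU1 inE => /orP[/eqP -> //|].
  case/imsetP => -[c A]; rewrite !inE /= => /and3P[Cc utA _] ->.
  by apply: upper_trigD => //; exact: hC.
rewrite cardsU1 XnotinI card_in_imset // cardsX.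
move=> /leq_trans /(_ (card_upper_trig_leq _ _)).
by rewrite -hperf /ball_size -/t -/ball -/code add1n ltnn.
Qed.
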